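(* For all $m,n\ge 1$, $|W_n^{-1}(P_m)| = |W_n^{-1}(K_{1,m})|$.
   Context: For $\pi=\pi_1\cdots\pi_n\in\mathcal{S}_n$, the digraph $D(\pi)$ has vertices $1,\dots,n$ and an arc from $j$ to $i$ whenever $i<j$ and $\pi_i<\pi_j$. The weighted competition graph $W(\pi)$ is the edge-weighted simple graph on the same vertices in which distinct $u,v$ are joined by an edge iff they have a common out-neighbor in $D(\pi)$, with weight equal to the number of common out-neighbors. $P_m$ is the path with $m+1$ vertices and $m$ edges, and $K_{1,m}$ is the star with one center and $m$ leaves, in both cases with all edge weights equal to $1$. For an edge-weighted graph $G$, $W_n^{-1}(G)$ is the set of $\pi\in\mathcal{S}_n$ such that $W(\pi)$ is isomorphic, as an edge-weighted graph, to $G$ together with some number of isolated vertices. *)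

(* Defs.v *)
From HB Require Import structures.
From mathcomp Require Import all_boot all_fingroup.
From mathcomp Require Import boolp.

Set Implicit Arguments.
Unset Strict Implicit.
Unset Printing Implicit Defensive.

(* Edge-weighted simple graphs.  The value of [weight] on a pair of
   non-adjacent vertices is irrelevant (see [wgraph_iso]). *)
Record wgraph := WGraph {
  vertex : finType;
  adj : rel vertex;
  weight : vertex -> vertex -> nat;
  adj_sym : symmetric adj;
  adj_irr : irreflexive adj;
  weight_sym : forall u v, weight u v = weight v u
}.

Definition wgraph_iso (G H : wgraph) : Prop :=
  exists f : vertex G -> vertex H,
    [/\ bijective f,
        forall u v, adj (f u) (f v) = adj u v
      & forall u v, adj u v -> weight (f u) (f v) = weight u v].

Section AddIsolated.
Variables (G : wgraph) (k : nat).

Definition isolated_adj (x y : vertex G + 'I_k) : bool :=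
  match x, y with
  | inl u, inl v => adj u v
  | _, _ => false
  end.

Definition isolated_weight (x y : vertex G + 'I_k) : nat :=
  match x, y with
  | inl u, inl v => weight u v
  | _, _ => 0
  end.

Lemma isolated_adj_sym : symmetric isolated_adj.
Proof. by move=> [u|i] [v|j] //=; apply: adj_sym. Qed.

Lemma isolated_adj_irr : irreflexive isolated_adj.
Proof. by move=> [u|i] //=; apply: adj_irr. Qed.

Lemma isolated_weight_sym x y : isolated_weight x y = isolated_weight y x.
Proof. by case: x y => [u|i] [v|j] //=; apply: weight_sym. Qed.

Definition add_isolated : wgraph :=
  WGraph isolated_adj_sym isolated_adj_irr isolated_weight_sym.

End AddIsolated.

Section Competition.
Variables (n : nat) (pi : 'S_n).

(* The arc goes from [j] to [i]. *)
Definition arc (j i : 'I_n) : bool := (i < j) && (pi i < pi j).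

Definition common_out (u v : 'I_n) : {set 'I_n} :=
  [set i | arc u i & arc v i].

Definition comp_adj (u v : 'I_n) : bool :=
  (u != v) && [exists i, i \in common_out u v].

Definition comp_weight (u v : 'I_n) : nat := #|common_out u v|.

Lemma common_outC u v : common_out u v = common_out v u.
Proof. by apply/setP => i; rewrite !inE andbC. Qed.

Lemma comp_adj_sym : symmetric comp_adj.
Proof. by move=> u v; rewrite /comp_adj eq_sym common_outC. Qed.

Lemma comp_adj_irr : irreflexive comp_adj.
Proof. by move=> u; rewrite /comp_adj eqxx. Qed.

Lemma comp_weight_sym u v : comp_weight u v = comp_weight v u.
Proof. by rewrite /comp_weight common_outC. Qed.

Definition competition_graph : wgraph :=
  WGraph comp_adj_sym comp_adj_irr comp_weight_sym.

End Competition.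

Section PathStar.
Variable m : nat.

Definition path_adj (u v : 'I_m.+1) : bool := (u.+1 == v) || (v.+1 == u).

Lemma path_adj_sym : symmetric path_adj.
Proof. by move=> u v; rewrite /path_adj orbC. Qed.

Lemma path_adj_irr : irreflexive path_adj.
Proof. by move=> u; rewrite /path_adj orbb eqn_leq ltnn. Qed.

(* [m] counts edges: there are [m + 1] vertices. *)
Definition path_graph : wgraph :=
  @WGraph _ path_adj (fun _ _ => 1) path_adj_sym path_adj_irr
    (fun _ _ => erefl).

(* The center is [ord0]. *)
Definition star_adj (u v : 'I_m.+1) : bool :=
  (u != v) && ((u == ord0) || (v == ord0)).

Lemma star_adj_sym : symmetric star_adj.
Proof. by move=> u v; rewrite /star_adj eq_sym orbC. Qed.

Lemma star_adj_irr : irreflexive star_adj.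
Proof. by move=> u; rewrite /star_adj eqxx. Qed.

Definition star_graph : wgraph :=
  @WGraph _ star_adj (fun _ _ => 1) star_adj_sym star_adj_irr
    (fun _ _ => erefl).

End PathStar.

Definition W_inv (n : nat) (G : wgraph) : {set 'S_n} :=
  [set pi | `[< exists k, wgraph_iso (competition_graph pi)
                                     (add_isolated G k) >]].

(* Main.v *)
Require Import Defs.
From mathcomp Require Import all_boot all_fingroup.
From mathcomp Require Import zify boolp.

Set Implicit Arguments.
Unset Strict Implicit.
Unset Printing Implicit Defensive.

(* Insert the positions of [pi] from right to left and let the letter [w t] be
   the number of larger values already inserted when the [t]-th one arrives;
   this code determines [pi], and every word with [w t <= t] occurs.  The graph
   [W(pi)] can only be triangle-free if all letters are at most 2.  Then only
   the two largest values so far matter: a letter 0 inserts a new top, a letter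
   1 a new second, and a letter 2 creates an edge between the two.  All edges
   have weight 1 iff no two letters 2 are adjacent, and the edges form a tree
   iff moreover each 0 between two letters 2 is immediately followed by a 2;
   each edge then contains the top at the preceding edge and the vertex inserted
   just before it.  Such a tree is a path (resp. a star) iff the letter
   preceding each 2, except the first and the last, is 0 (resp. 1), because this
   letter decides whether the next edge is attached to the newest vertex or to
   the old top.  Exchanging 0 and 1 at these places is the bijection. *)

(* [(top, bot)]: the vertices carrying the two largest values inserted before
   time [t]; [bot] is meaningless for [t < 2], and [top] for [t = 0]. *)
Fixpoint top2 (w : nat -> nat) (t : nat) : nat * nat :=
  if t is r.+1 then
    let: (a, b) := top2 w r in
    match w r with 0 => (r, a) | 1 => (a, r) | _ => (a, b) end
  else (0, 0).

Definition top w t := (top2 w t).1.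
Definition bot w t := (top2 w t).2.

Definition edge w t u v :=
  (u == top w t) && (v == bot w t) || (u == bot w t) && (v == top w t).

Definition word_adj n w u v := exists t, [/\ t < n, w t = 2 & edge w t u v].

(* The tree on [0 .. m] in which [k.+1] has parent [par k]: the identity gives
   the path and the constant 0 the star. *)
Definition tree_adj (par : nat -> nat) i j :=
  (0 < j) && (par j.-1 == i) || (0 < i) && (par i.-1 == j).

(** [h] embeds the tree, vertices outside its image are isolated, and the last clause encodes the
    weights 1: no two letters 2 create the same edge. *)
Definition tree_word par m n w := exists h : nat -> nat,
  [/\ forall i j, i <= m -> j <= m -> h i = h j -> i = j,
      forall i j, i <= m -> j <= m ->
        word_adj n w (h i) (h j) <-> tree_adj par i j,
      forall u v, word_adj n w u v -> exists2 i, i <= m & u = h i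
    & forall s t u v, s < n -> t < n -> w s = 2 -> w t = 2 ->
        edge w s u v -> edge w t u v -> s = t].

Definition twos n (w : nat -> nat) := [seq t <- iota 0 n | w t == 2].

Definition chain_word m n w :=
  [/\ forall t, t < n -> w t <= 2,
      forall t, t.+1 < n -> w t = 2 -> w t.+1 <> 2,
      forall s r t, s < r -> r < t -> t < n -> w s = 2 -> w t = 2 ->
        w r = 0 -> w r.+1 = 2
    & size (twos n w) = m].

(** In a chain word these are the places just before a 2 that is neither the first nor the last one,
    where 0 and 1 get exchanged. *)
Definition inner n (w : nat -> nat) r :=
  [&& w r.+1 == 2, has (fun s => w s == 2) (iota 0 r)
    & has (fun t => w t == 2) (iota r.+2 (n - r.+2))].

Lemma innerP n w r :
  reflect (exists s t, [/\ s < r, r.+1 < t < n, w s = 2, w r.+1 = 2 & w t = 2])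
          (inner n w r).
Proof.
apply: (iffP and3P) => [[/eqP wr /hasP[s sr /eqP ws] /hasP[t tr /eqP wt]]|].
  by exists s, t; move: sr tr; rewrite !mem_iota; split=> //; lia.
case=> s [t [sr rt ws wr wt]]; split; first by rewrite wr.
  by apply/hasP; exists s; rewrite ?ws // mem_iota; lia.
by apply/hasP; exists t; rewrite ?wt // mem_iota; lia.
Qed.

Definition consecutive n (w : nat -> nat) s t :=
  [/\ s < t < n, w s = 2, w t = 2 & forall r, s < r < t -> w r <> 2].

Lemma consecutive_prev n w s t :
  s < t < n -> w s = 2 -> w t = 2 -> exists s', consecutive n w s' t.
Proof.
move=> stn ws wt.
pose P r := (r < t) && (w r == 2).
have exP : exists r, P r by exists s; rewrite /P ws; lia.
have ubP r : P r -> r <= t by move=> /andP[]; lia.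
case: (ex_maxnP exP ubP) => r /andP[rt /eqP wr] rmax; exists r; split=> //.
  by lia.
by move=> q qr wq; have := rmax q; rewrite /P wq; lia.
Qed.

Lemma consecutive_next n w s t :
  s < t < n -> w s = 2 -> w t = 2 -> exists t', consecutive n w s t'.
Proof.
move=> stn ws wt.
pose P r := (s < r < n) && (w r == 2).
have exP : exists r, P r by exists t; rewrite /P wt; lia.
case: (ex_minnP exP) => r /andP[rt /eqP wr] rmin; exists r; split=> //.
by move=> q qr wq; have := rmin q; rewrite /P wq; lia.
Qed.

(** * The two top vertices and the edges of a word *)

Section Word.
Variables (n : nat) (w : nat -> nat).
Hypothesis w_le : forall t, w t <= t.

Lemma topS t : top w t.+1 = if w t == 0 then t else top w t.
Proof. by rewrite /top /=; case: (top2 w t) => a b; case: (w t) => [|[|k]]. Qed.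

Lemma botS t : bot w t.+1 =
  if w t == 0 then top w t else if w t == 1 then t else bot w t.
Proof.
by rewrite /top /bot /=; case: (top2 w t) => a b; case: (w t) => [|[|k]].
Qed.

Lemma top_lt t : 0 < t -> top w t < t.
Proof.
case: t => // t _; elim: t => [|t IH]; rewrite topS.
  by have := w_le 0; case: eqP => //; lia.
by case: eqP => _ //; lia.
Qed.

(** By [w_le] the first letter is 0 and the second at most 1, so two insertions fill both slots with
    distinct vertices. *)
Lemma bot_lt t : 1 < t -> bot w t < t /\ bot w t <> top w t.
Proof.
case: t => [|[|t]] // _; elim: t => [|t IH]; rewrite topS botS.
  have := top_lt (ltnSn 0); have := w_le 1.
  by case: (w 1) => [|[|k]] //=; lia.
have := top_lt (ltn0Sn t.+1).
by case: (w t.+2) => [|[|k]] //=; lia.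
Qed.

Lemma two_gt1 t : w t = 2 -> 1 < t.
Proof. by move=> wt; have := w_le t; lia. Qed.

Lemma edge_top_bot t : edge w t (top w t) (bot w t).
Proof. by rewrite /edge !eqxx. Qed.

Lemma edge_bot_top t : edge w t (bot w t) (top w t).
Proof. by rewrite /edge !eqxx orbT. Qed.

Lemma edgeC t u v : edge w t u v = edge w t v u.
Proof. by rewrite /edge orbC andbC [X in _ || X]andbC. Qed.

Lemma edge_lt t u v : w t = 2 -> edge w t u v -> [/\ u < t, v < t & u <> v].
Proof.
move=> /two_gt1 t1; have := bot_lt t1; have := top_lt (ltnW t1).
by rewrite /edge => *; split; lia.
Qed.

(** A letter only moves [top] into [bot] or brings in its own time as a new vertex, and that time is
    at least [r]. *)
Lemma top2_ge r t t' : r <= t <= t' -> r <= top w t -> r <= bot w t ->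
  r <= top w t' /\ r <= bot w t'.
Proof.
move=> /andP[rt] /subnKC <-; elim: (t' - t) => [|d IH] hr hb.
  by rewrite addn0.
have [] := IH hr hb; rewrite addnS topS botS.
by case: (w _) => [|[|k]] /=; lia.
Qed.

Section Chain.
Variable m : nat.
Hypothesis wQ : chain_word m n w.

(** A 0 between two consecutive 2s must be followed by a 2, so it can only stand just before [t],
    and [top] is constant until then. The letter before [t] puts its vertex below the old top
    (letter 1) or above it (letter 0). *)
Lemma consecutive_step s t : consecutive n w s t -> s.+1 < t /\
  (w t.-1 = 1 /\ top w t = top w s /\ bot w t = t.-1 \/
   w t.-1 = 0 /\ top w t = t.-1 /\ bot w t = top w s).
Proof.
case: wQ => w2 no22 zero _ [stn ws wt gap].
have st : s.+1 < t.
  have [//|ts] := ltnP s.+1 t; have e : t = s.+1 by lia.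
  by subst t; case: (no22 s) => //; lia.
split=> //.
have topE r : s < r < t -> top w r = top w s.
  elim: r => // r IH srt; rewrite topS.
  have [sr|rs] := ltnP s r; last by have -> : r = s; [lia | rewrite ws].
  case: eqP => w0; last by rewrite IH //; lia.
  by case: (gap r.+1) => //; apply: (zero s r t) => //; lia.
case: t st stn wt gap topE => // t st stn wt gap topE; rewrite /= topS botS topE; last lia.
have := w2 t; have := gap t.
by case: (w t) => [|[|[|k]]] /=; lia.
Qed.

Lemma pred_two_edge s t u v : s < t < n -> w s = 2 -> w t = 2 ->
  edge w t u v -> u = t.-1 \/ v = t.-1.
Proof.
move=> stn ws wt; have [s' /consecutive_step[_]] := consecutive_prev stn ws wt.
by rewrite /edge; lia.
Qed.

(** The later edge contains the vertex inserted just before it, whereas both ends of the earlier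
    edge were inserted before the earlier 2. *)
Lemma edge_inj s t u v : s < n -> t < n -> w s = 2 -> w t = 2 ->
  edge w s u v -> edge w t u v -> s = t.
Proof.
have main s' t' : s' < t' -> s' < n -> t' < n -> w s' = 2 -> w t' = 2 ->
    edge w s' u v -> edge w t' u v -> False.
  move=> st sn tn ws wt es et.
  have stn : s' < t' < n by lia.
  have := pred_two_edge stn ws wt et; have := edge_lt ws es; have := wQ.
  case=> _ no22 _ _ [us vs _].
  have := no22 s'; case: (eqVneq s'.+1 t') => [<-|]; first by lia.
  by lia.
move=> sn tn ws wt es et; case: (ltngtP s t) => // st.
  by case: (main s t).
by case: (main t s).
Qed.

End Chain.

Lemma mem_twos t : (t \in twos n w) = (t < n) && (w t == 2).
Proof. by rewrite mem_filter mem_iota andbC. Qed.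

Lemma uniq_twos : uniq (twos n w).
Proof. exact/filter_uniq/iota_uniq. Qed.

Lemma twos_consecutive k : k.+1 < size (twos n w) ->
  consecutive n w (nth 0 (twos n w) k) (nth 0 (twos n w) k.+1).
Proof.
move=> km; set ts := twos n w.
have srt : sorted ltn ts.
  by apply: sorted_filter; [exact: ltn_trans | exact: iota_ltn_sorted].
have mem j : j < size ts -> nth 0 ts j < n /\ w (nth 0 ts j) = 2.
  by move=> jm; have := mem_nth 0 jm; rewrite mem_twos => /andP[? /eqP].
have homo := sorted_ltn_nth ltn_trans 0 srt.
have mono i j : i < size ts -> j < size ts ->
    (nth 0 ts i < nth 0 ts j) = (i < j).
  move=> im jm; case: (ltngtP i j) => [ij|ji|->]; last by rewrite ltnn.
    exact: homo.
  by have := homo _ _ jm im ji; lia.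
have [kn wk] := mem k (ltnW km); have [kn1 wk1] := mem _ km.
split=> //; first by rewrite kn1 andbT; apply: homo => //; apply: ltnW.
move=> r /andP[kr rk] wr.
have rts : r \in ts by rewrite mem_twos wr; lia.
have im : index r ts < size ts by rewrite index_mem.
have rE := nth_index 0 rts; rewrite -rE in kr rk.
move: kr rk; rewrite (mono _ _ (ltnW km) im) (mono _ _ im km); lia.
Qed.

End Word.

(** Pigeonhole for a relation: [find] picks one related element of [B] for each [a], and this choice
    is injective. *)
Lemma size_leq_rel (T U : eqType) (R : T -> U -> bool) (A : seq T) (B : seq U) :
    uniq A -> (forall a, a \in A -> exists2 b, b \in B & R a b) ->
    (forall a a' b, a \in A -> a' \in A -> b \in B -> R a b -> R a' b -> a = a') ->
  size A <= size B.
Proof.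
case: B => [|b0 B'] uA RA Rinj.
  by case: A uA RA {Rinj} => // a A _ /(_ a (mem_head _ _))[].
set B := b0 :: B'; pose f a := nth b0 B (find (R a) B).
have hasB a : a \in A -> has (R a) B.
  by move=> /RA[b bB Rab]; apply/hasP; exists b.
have fB a : a \in A -> f a \in B by move=> /hasB; rewrite has_find; apply: mem_nth.
have fR a : a \in A -> R a (f a) by move=> /hasB; apply: nth_find.
have finj : {in A &, injective f}.
  move=> a a' aA a'A faa'; apply: (Rinj a a' (f a)) => //; rewrite ?fB ?fR //.
  by rewrite faa' fR.
rewrite -(size_map f A); apply: uniq_leq_size; first by rewrite map_inj_in_uniq.
by move=> _ /mapP[a aA ->]; apply: fB.
Qed.

(** * Words whose edges form a tree *)

Section Tree.
Variables (n m : nat) (w par : nat -> nat).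
Hypothesis w_le : forall t, w t <= t.
Hypothesis par_le : forall k, par k <= k.

Lemma tree_adj_par k : tree_adj par (par k) k.+1.
Proof. by rewrite /tree_adj /= eqxx. Qed.

Lemma tree_word_chain :
  (forall t, t < n -> w t <= 2) -> tree_word par m n w -> chain_word m n w.
Proof.
move=> w2 [h [hinj hadj hcov hwt]].
have adj_par k : k < m -> word_adj n w (h (par k)) (h k.+1).
  by move=> km; apply/hadj; rewrite ?tree_adj_par //; have := par_le k; lia.
split=> //.
(* A letter 2 changes neither slot, so two adjacent letters 2 would create the same edge twice. *)
- move=> t tn wt wt1.
  have := hwt t t.+1 _ _ (ltnW tn) tn wt wt1 (edge_top_bot w t).
  rewrite /edge topS botS wt /= !eqxx => /(_ isT); lia.
(* If the 0 at [r] is not followed by a 2, both slots hold vertices at least [r] from time [r.+2]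
   on, while all earlier edges lie below [r]. So no edge crosses [r], although edges exist on both
   sides: the tree would be disconnected. *)
- move=> s r t sr rt tn ws wt wr; apply/eqP/negPn/negP => /eqP wr1.
  have rt2 : r.+2 <= t.
    by case: (eqVneq r.+1 t) => [e|]; [rewrite e in wr1 | lia].
  have top_r : top w r.+1 = r by rewrite topS wr.
  have low q : q < n -> w q = 2 -> q <= r ->
    top w q < r /\ bot w q < r.
    move=> qn wq qr; have q1 := two_gt1 w_le wq.
    have qr' : q <> r by move=> e; rewrite e wr in wq.
    by have := top_lt w_le (ltnW q1); have [] := bot_lt w_le q1; lia.
  have high q : w q = 2 -> r < q -> r <= top w q /\ r <= bot w q.
    move=> wq rq.
    have rq2 : r.+2 <= q.
      by case: (eqVneq r.+1 q) => [e|]; [rewrite e in wr1 | lia].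
    apply: (@top2_ge w r r.+2); first by lia.
      by rewrite topS top_r; case: ifP; lia.
    rewrite botS top_r; have := w2 r.+1.
    by case: (w r.+1) wr1 => [|[|[|k]]] //=; lia.
  have closed u v : word_adj n w u v -> (u < r) = (v < r).
    case=> q [qn wq]; rewrite /edge => e.
    by case: (leqP q r) => qr; [have [] := low q qn wq qr | have [] := high q wq qr]; lia.
  have conn i : i <= m -> (h i < r) = (h 0 < r).
    elim/ltn_ind: i => -[|k] IH // km; rewrite -(closed _ _ (adj_par k km)).
    by apply: IH; have := par_le k; lia.
  have [|i im ei] := hcov (top w s) (bot w s).
    by exists s; rewrite edge_top_bot; split=> //; lia.
  have [|j jm ej] := hcov (top w t) (bot w t).
    by exists t; rewrite edge_top_bot; split=> //; lia.
  have := conn i im; have := conn j jm; rewrite -ei -ej.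
  by have [] := low s _ ws; have [] := high t wt; lia.
(* [R t k]: the letter 2 at [t] creates the tree edge from [k.+1] to its parent. Counting along [R]
   in both directions matches the letters 2 with the [m] tree edges. *)
- pose R t k := edge w t (h (par k)) (h k.+1).
  have Rk t k k' : k < m -> k' < m -> R t k -> R t k' -> k = k'.
    move=> km k'm; rewrite /R /edge => Rk Rk'.
    have pk := par_le k; have pk' := par_le k'.
    have [[e1 e2]|[e1 e2]] : h (par k) = h (par k') /\ h k.+1 = h k'.+1 \/
        h (par k) = h k'.+1 /\ h k.+1 = h (par k') by lia.
      by have := hinj k.+1 k'.+1; lia.
    (* The crossed case would give [par k = k'.+1] and [par k' = k.+1], against [par k <= k] and
       [par k' <= k']. *)
    have := hinj (par k) k'.+1; have := hinj k.+1 (par k'); lia.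
  have Rt t t' k : t \in twos n w -> t' \in twos n w -> R t k -> R t' k -> t = t'.
    rewrite !mem_twos => /andP[tn /eqP wt] /andP[tn' /eqP wt'].
    exact: hwt.
  rewrite -[RHS](size_iota 0 m); apply/eqP; rewrite eqn_leq; apply/andP; split.
    apply: (@size_leq_rel _ _ R) => [|t tt|a a' b aA a'A _]; first exact: uniq_twos.
      have := tt; rewrite mem_twos => /andP[tn /eqP wt].
      have adj_t : word_adj n w (top w t) (bot w t).
        by exists t; rewrite edge_top_bot.
      have adj_t' : word_adj n w (bot w t) (top w t).
        by exists t; rewrite edge_bot_top.
      have [i im ei] := hcov _ _ adj_t.
      have [j jm ej] := hcov _ _ adj_t'.
      move: adj_t; rewrite ei ej => /hadj; rewrite /tree_adj => /(_ im jm) ij.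
      have [[j0 pj]|[i0 pi]] : 0 < j /\ par j.-1 = i \/ 0 < i /\ par i.-1 = j by lia.
        exists j.-1; first by rewrite mem_iota; lia.
        by rewrite /R pj prednK // -ei -ej edge_top_bot.
      exists i.-1; first by rewrite mem_iota; lia.
      by rewrite /R pi prednK // -ei -ej edge_bot_top.
    exact: Rt.
  apply: (@size_leq_rel _ _ (fun k t => R t k)) => [|k|k k' t]; first exact: iota_uniq.
    rewrite mem_iota => km; have [t [tn wt et]] := adj_par k km.
    by exists t => //; rewrite mem_twos tn wt.
  by rewrite !mem_iota => km k'm _; apply: Rk.
Qed.

(* The edge [{top, bot}] of each 2 after the first consists of the vertex
   inserted just before it and of the top at the preceding 2. *)
Lemma chain_word_tree (h : nat -> nat) (ts := twos n w) :
    0 < m -> chain_word m n w -> par 0 = 0 ->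
    edge w (nth 0 ts 0) (h 0) (h 1) ->
    (forall k, 0 < k < m -> h k.+1 = (nth 0 ts k).-1) ->
    (forall k, k.+1 < m -> top w (nth 0 ts k) = h (par k.+1)) ->
  tree_word par m n w.
Proof.
move=> m0 wQ par0 h01 hS hpar; have [w2 no22 zero sm] := wQ.
have mem k : k < m -> nth 0 ts k < n /\ w (nth 0 ts k) = 2.
  by rewrite -sm => km; have := mem_nth 0 km; rewrite mem_twos => /andP[? /eqP].
have cons k : k.+1 < m -> consecutive n w (nth 0 ts k) (nth 0 ts k.+1).
  by move=> km; apply: twos_consecutive; rewrite sm.
have gap k : k.+1 < m -> (nth 0 ts k).+1 < nth 0 ts k.+1.
  by move=> km; have [] := consecutive_step wQ (cons k km).
have edgeE k : k < m -> edge w (nth 0 ts k) (h (par k)) (h k.+1).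
  case: k => [|k] km; first by rewrite par0.
  rewrite -hpar // hS; last by lia.
  have [_] := consecutive_step wQ (cons k km).
  by rewrite /edge; lia.
have h_lt k : k < m -> h k.+1 < nth 0 ts k.
  by move=> km; have [_ wk] := mem k km; have [_ ] := edge_lt w_le wk (edgeE k km).
have h_lt' j i : i <= j.+1 -> j < m -> h i < nth 0 ts j.
  elim: j i => [|j IH] i ij jm.
    have [_ wk] := mem 0 m0; have [h0 h1 _] := edge_lt w_le wk h01.
    by case: i ij => [|[|i]].
  have [->|ij'] : i = j.+2 \/ i <= j.+1 by lia.
    exact: h_lt.
  by have := IH i; have := gap j; lia.
(* The vertex [h j.+2] lies just before the 2 of index [j.+1], hence beyond the 2 of index [j],
   before which all [h i] with [i <= j.+1] were inserted. *)
have hneq i j : i < j -> j <= m -> h i <> h j.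
  case: j => [|[|j]] // ij jm.
    have -> : i = 0 by lia.
    by have [_ wk] := mem 0 m0; have [] := edge_lt w_le wk h01.
  by have := gap j jm; have := @h_lt' j i; rewrite hS; lia.
have hinj i j : i <= m -> j <= m -> h i = h j -> i = j.
  move=> im jm e; case: (ltngtP i j) => // ij.
    by case: (hneq i j).
  by case: (hneq j i).
have edgeP t : t < n -> w t = 2 ->
    exists2 k, k < m & forall u v, edge w t u v ->
      u = h (par k) /\ v = h k.+1 \/ u = h k.+1 /\ v = h (par k).
  move=> tn wt; have tts : t \in ts by rewrite mem_twos tn wt.
  have km : index t ts < m by rewrite -sm index_mem.
  exists (index t ts) => // u v.
  by have := edgeE _ km; rewrite nth_index // /edge; lia.
exists h; split=> //.
- move=> i j im jm; split=> [[t [tn wt]]|].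
    have [k km H] := edgeP t tn wt => /H; have pk := par_le k.
    case=> -[]; rewrite /tree_adj.
      by move=> /hinj -> //; [move=> /hinj -> // | lia]; rewrite /= eqxx.
    move=> /hinj -> //; move=> /hinj -> //; last lia.
    by rewrite /= eqxx orbT.
  rewrite /tree_adj => /orP[] /andP[].
    case: j jm => // j jm _ /eqP <-; exists (nth 0 ts j).
    by have [? ?] := mem j jm; rewrite edgeE.
  case: i im => // i im _ /eqP <-; exists (nth 0 ts i).
  by have [? ?] := mem i im; rewrite edgeC edgeE.
- move=> u v [t [tn wt]]; have [k km H] := edgeP t tn wt => /H.
  have pk := par_le k.
  by case=> -[-> _]; [exists (par k) => //; lia | exists k.+1].
- by move=> s t u v; apply: (edge_inj w_le wQ).
Qed.

End Tree.

(** * Words of paths and of stars *)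

Definition inner_eq n w b := forall r, inner n w r -> w r = b.

Section PathStarWord.
Variables (n m : nat) (w : nat -> nat).
Hypothesis w_le : forall t, w t <= t.
Hypothesis m_gt0 : 0 < m.

Lemma inner_consecutive r : inner n w r ->
  exists s t, consecutive n w s r.+1 /\ consecutive n w r.+1 t.
Proof.
move=> /innerP[s [t [sr rt ws wr wt]]].
have [|s' cs'] := @consecutive_prev n w s r.+1 _ ws wr; first by lia.
have [|t' ct'] := @consecutive_next n w r.+1 t _ wr wt; first by lia.
by exists s', t'.
Qed.

(** An inner letter 1 keeps the old top, so the edges at three consecutive 2s share [top w s]; a
    path has no vertex with three neighbors. *)
Lemma path_word_inner :
  chain_word m n w -> tree_word id m n w -> inner_eq n w 0.
Proof.
move=> wQ [h [hinj hadj hcov _]] r /inner_consecutive[s [t [cs ct]]].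
have [str [[wr [topr botr]]|[]//]] := consecutive_step wQ cs; rewrite /= in wr botr.
have [rt stp] := consecutive_step wQ ct.
have [srn ws wr1 _] := cs; have [rtn _ wt _] := ct.
have adjs : word_adj n w (top w s) (bot w s).
  by exists s; rewrite edge_top_bot; split=> //; lia.
have adjr : word_adj n w (top w s) r.
  by exists r.+1; rewrite /edge; split=> //; lia.
have adjt : word_adj n w (top w s) t.-1.
  by exists t; rewrite /edge; split=> //; lia.
have [bs _] := bot_lt w_le (two_gt1 w_le ws).
have sym u v : word_adj n w u v -> word_adj n w v u.
  by case=> q [qn wq e]; exists q; rewrite edgeC.
have [i im ei] := hcov _ _ adjs.
have [j1 j1m e1] := hcov _ _ (sym _ _ adjs).
have [j2 j2m e2] := hcov _ _ (sym _ _ adjr).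
have [j3 j3m e3] := hcov _ _ (sym _ _ adjt).
move: adjs adjr adjt; rewrite ei e1 e2 e3 => /hadj a1 /hadj a2 /hadj a3.
have {a1} := a1 im j1m; have {a2} := a2 im j2m; have {a3} := a3 im j3m.
have n12 : j1 <> j2 by move=> e; rewrite e in e1; lia.
have n13 : j1 <> j3 by move=> e; rewrite e in e1; lia.
have n23 : j2 <> j3 by move=> e; rewrite e in e2; lia.
by rewrite /tree_adj; lia.
Qed.

(** An inner letter 0 replaces the top, so the edge at [t] joins [r] and [t.-1] and is disjoint from
    the edge at [s]; in a star any two edges meet. *)
Lemma star_word_inner :
  chain_word m n w -> tree_word (fun=> 0) m n w -> inner_eq n w 1.
Proof.
move=> wQ [h [hinj hadj hcov _]] r /inner_consecutive[s [t [cs ct]]].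
have [str [[]//|[wr [topr botr]]]] := consecutive_step wQ cs; rewrite /= in wr topr.
have [rt stp] := consecutive_step wQ ct.
have [srn ws wr1 _] := cs; have [rtn _ wt _] := ct.
have adjs : word_adj n w (top w s) (bot w s).
  by exists s; rewrite edge_top_bot; split=> //; lia.
have adjt : word_adj n w r t.-1.
  by exists t; rewrite /edge; split=> //; lia.
have s1 := two_gt1 w_le ws.
have [bs bts] := bot_lt w_le s1; have ts := top_lt w_le (ltnW s1).
have sym u v : word_adj n w u v -> word_adj n w v u.
  by case=> q [qn wq e]; exists q; rewrite edgeC.
have [i im ei] := hcov _ _ adjs.
have [j jm ej] := hcov _ _ (sym _ _ adjs).
have [k km ek] := hcov _ _ adjt.
have [l lm el] := hcov _ _ (sym _ _ adjt).
move: adjs adjt; rewrite ei ej ek el => /hadj a1 /hadj a2.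
have {a1} := a1 im jm; have {a2} := a2 km lm.
have nik : i <> k by move=> e; rewrite e in ei; lia.
have nil : i <> l by move=> e; rewrite e in ei; lia.
have njk : j <> k by move=> e; rewrite e in ej; lia.
have njl : j <> l by move=> e; rewrite e in ej; lia.
by rewrite /tree_adj; lia.
Qed.

Lemma twos_inner k : chain_word m n w -> k.+2 < m ->
  inner n w (nth 0 (twos n w) k.+1).-1.
Proof.
move=> wQ km; have sm : size (twos n w) = m by case: wQ.
have [|k1n wk wk1 _] := @twos_consecutive n w k; first by lia.
have [|k2n _ wk2 _] := @twos_consecutive n w k.+1; first by lia.
have [|st _] := consecutive_step wQ (@twos_consecutive n w k _); first by lia.
apply/innerP; exists (nth 0 (twos n w) k), (nth 0 (twos n w) k.+2).
by rewrite prednK; [split=> //; lia | lia].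
Qed.

Lemma path_wordP : (forall t, t < n -> w t <= 2) ->
  tree_word id m n w <-> chain_word m n w /\ inner_eq n w 0.
Proof.
move=> w2; split=> [wT | [wQ w0]].
  have wQ : chain_word m n w by apply: tree_word_chain wT.
  by split=> //; apply: path_word_inner.
have sm : size (twos n w) = m by case: wQ.
pose ts := twos n w.
(* The second edge contains the top at the first 2, so in the path this top is [h 1] and the free
   end [h 0] is [bot]. *)
apply: (@chain_word_tree n m w id w_le _
  (fun i => match i with 0 => bot w (nth 0 ts 0) | 1 => top w (nth 0 ts 0)
                       | k.+1 => (nth 0 ts k).-1 end)) => //.
- exact: edge_bot_top.
- by case.
(* The inner letter 0 makes the newest vertex the top, so the next edge continues the path. *)
- case=> [|k] km //.
  have [|_] := consecutive_step wQ (@twos_consecutive n w k _); first by lia.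
  by have := w0 _ (twos_inner wQ km); rewrite /ts; lia.
Qed.

Lemma star_wordP : (forall t, t < n -> w t <= 2) ->
  tree_word (fun=> 0) m n w <-> chain_word m n w /\ inner_eq n w 1.
Proof.
move=> w2; split=> [wT | [wQ w1]].
  have wQ : chain_word m n w by apply: tree_word_chain wT.
  by split=> //; apply: star_word_inner.
have sm : size (twos n w) = m by case: wQ.
pose ts := twos n w.
(* In the star the top at the first 2 is the center [h 0]. *)
apply: (@chain_word_tree n m w (fun=> 0) w_le _
  (fun i => match i with 0 => top w (nth 0 ts 0) | 1 => bot w (nth 0 ts 0)
                       | k.+1 => (nth 0 ts k).-1 end)) => //.
- exact: edge_top_bot.
- by case.
(* Inner letters 1 carry the same top from each 2 to the next. *)
- elim=> [|k IH] km //; rewrite -IH; last by lia.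
  have [|_] := consecutive_step wQ (@twos_consecutive n w k _); first by lia.
  by have := w1 _ (twos_inner wQ km); rewrite /ts; lia.
Qed.

End PathStarWord.

(** * The exchange of 0 and 1 *)

Definition flip n w r := if inner n w r && (w r < 2) then 1 - w r else w r.

Section Flip.
Variables (n : nat) (w : nat -> nat).

Lemma flip_eq2 t : (flip n w t == 2) = (w t == 2).
Proof. by rewrite /flip; case: ifP => // /andP[_]; lia. Qed.

Lemma inner_flip r : inner n (flip n w) r = inner n w r.
Proof.
rewrite /inner flip_eq2; congr [&& _, _ & _]; apply: eq_has => t;
  exact: flip_eq2.
Qed.

(** [inner] depends only on the places of the letters 2, which stay fixed, and the guard [w r < 2]
    keeps [1 - w r] invertible. *)
Lemma flipK t : flip n (flip n w) t = w t.
Proof.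
rewrite {1}/flip inner_flip /flip; case: (inner n w t) => //=.
by case: (w t) => [|[|k]].
Qed.

(** An inner place has a 2 before it, so it is at least 1, which bounds the exchanged letter. *)
Lemma flip_le t : (forall s, w s <= s) -> flip n w t <= t.
Proof.
move=> /(_ t) wt; rewrite /flip; case: ifP => // /andP[/innerP[s [q [st _ _ _ _]]] _].
by lia.
Qed.

Lemma chain_flip m : chain_word m n w -> chain_word m n (flip n w).
Proof.
have f2 t : flip n w t = 2 <-> w t = 2.
  by split=> /eqP; [rewrite flip_eq2 | rewrite -flip_eq2] => /eqP.
case=> w2 no22 zero sm; split.
- by move=> t /w2; rewrite /flip; case: ifP; lia.
- by move=> t tn /f2 wt /f2; apply: no22.
(* A 0 created by the exchange stands at an inner place and is therefore followed by a 2; any other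
   0 was already a 0 of [w]. *)
- move=> s r t sr rt tn /f2 ws /f2 wt; rewrite {1}/flip.
  case: ifP => [/andP[/innerP[s' [t' [_ _ _ wr _]]] _] _ | _ wr]; first exact/f2.
  exact/f2/(zero s r t).
- by rewrite -sm; congr size; apply: eq_filter => t; apply: flip_eq2.
Qed.

Lemma inner_eq_flip m b : chain_word m n w -> b <= 1 ->
  inner_eq n w b -> inner_eq n (flip n w) (1 - b).
Proof.
case=> w2 no22 _ _ b1 wb r; rewrite inner_flip => ir.
by rewrite /flip ir wb //=; case: ifP; lia.
Qed.

End Flip.

(** * From permutations to words *)

Definition greater_before (p : nat -> nat) t := [seq u <- iota 0 t | p t < p u].
(** The inversion table (Lehmer code) of [p]. *)
Definition code p t := size (greater_before p t).

(** [W(pi)] in insertion order: a common out-neighbor of [u] and [v] is a smaller value inserted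
    after both. *)
Definition perm_adj n p u v :=
  u <> v /\ exists t,
    [/\ t < n, u \in greater_before p t & v \in greater_before p t].

Definition tree_perm par m n p := exists h : nat -> nat,
  [/\ forall i j, i <= m -> j <= m -> h i = h j -> i = j,
      forall i j, i <= m -> j <= m ->
        perm_adj n p (h i) (h j) <-> tree_adj par i j,
      forall u v, perm_adj n p u v -> exists2 i, i <= m & u = h i
    & forall s t u v, s < n -> t < n -> u <> v ->
        u \in greater_before p s -> v \in greater_before p s ->
        u \in greater_before p t -> v \in greater_before p t -> s = t].

Section Code.
Variables (n : nat) (p : nat -> nat).
Hypothesis p_inj : forall u v, u < n -> v < n -> p u = p v -> u = v.

Lemma mem_greater t u : (u \in greater_before p t) = (u < t) && (p t < p u).
Proof. by rewrite mem_filter mem_iota andbC. Qed.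

Lemma uniq_greater t : uniq (greater_before p t).
Proof. exact/filter_uniq/iota_uniq. Qed.

Lemma code_le t : code p t <= t.
Proof. by rewrite /code size_filter (leq_trans (count_size _ _)) ?size_iota. Qed.

Lemma code0 t a : (forall u, u < t -> u <> a -> p u < p a) -> p a < p t ->
  code p t = 0.
Proof.
move=> ha at_; apply/eqP; rewrite size_eq0 -[_ == _]negbK -has_filter.
apply/hasPn => u; rewrite mem_iota => ut.
by have := ha u; case: (eqVneq u a) => [->|]; lia.
Qed.

Lemma code1 t a : a < t -> (forall u, u < t -> u <> a -> p u < p t) ->
  p t < p a -> code p t = 1.
Proof.
move=> at_ ha ta; rewrite -[1]/(size [:: a]); apply/perm_size/uniq_perm => //.
  exact: uniq_greater.
move=> u; rewrite mem_greater mem_seq1; apply/idP/eqP => [|->]; last lia.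
by move=> ut; have := ha u; lia.
Qed.

Lemma code2 t a b : a < t -> b < t -> a <> b -> p t < p a -> p t < p b ->
  2 <= code p t /\
  (code p t = 2 -> forall u, (u \in greater_before p t) = (u == a) || (u == b)).
Proof.
move=> at_ bt ab ta tb.
have uab : uniq [:: a; b] by rewrite /= inE andbT; apply/eqP.
have sub : {subset [:: a; b] <= greater_before p t}.
  by move=> u; rewrite !inE mem_greater => /orP[] /eqP ->; lia.
split=> [|c2 u]; first exact: (uniq_leq_size uab sub).
have [|_ <-] := uniq_min_size uab sub; first by rewrite -/(code p t) c2.
by rewrite !inE.
Qed.

Hypothesis code_le2 : forall t, t < n -> code p t <= 2.
Let w := code p.

(** Although [top2] reads only the code, its slots hold the two largest values: a new value above
    both has letter 0, one between them letter 1, and one below both a letter at least 2, which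
    changes nothing. *)
Lemma top2_max t : 0 < t <= n ->
  (forall u, u < t -> u <> top w t -> p u < p (top w t)) /\
  (1 < t -> forall u, u < t -> u <> top w t -> u <> bot w t -> p u < p (bot w t)).
Proof.
case: t => // t; elim: t => [_|t IH tn].
  by split=> // u; have := top_lt code_le (ltn0Sn 0); rewrite -/w; lia.
have [|Htop Hbot] := IH; first by lia.
have top_t := top_lt code_le (ltn0Sn t); rewrite -/w in top_t.
have neq u : u < t.+1 -> p u <> p t.+1 by move=> ut /p_inj; lia.
rewrite topS botS.
have [lt1|lt1|] := ltngtP (p t.+1) (p (top w t.+1)); last first.
- by have := neq _ top_t; lia.
- have -> /= : w t.+1 = 0 by apply: (@code0 _ (top w t.+1)).
  split=> [u ut un|_ u ut un1 un2].
    by case: (eqVneq u (top w t.+1)) => [->|] //; have := Htop u; lia.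
  by apply: Htop; lia.
case: (leqP t.+1 1) => t1.
  have e0 u : u < t.+1 -> u = top w t.+1 by lia.
  have -> /= : w t.+1 = 1 by apply: (@code1 _ (top w t.+1)) => // u /e0.
  split=> [u ut un|_ u ut un1 un2]; last by have := e0 u; lia.
  have [e|/e0//] : u = t.+1 \/ u < t.+1 by lia.
  by rewrite e.
have [bot_t bot_top] := bot_lt code_le t1; rewrite -/w in bot_t bot_top.
have {}Hbot := Hbot t1.
have [lt2|lt2|] := ltngtP (p t.+1) (p (bot w t.+1)); last first.
- by have := neq _ bot_t; lia.
- have lt3 u : u < t.+1 -> u <> top w t.+1 -> p u < p t.+1.
    by move=> ut un; case: (eqVneq u (bot w t.+1)) => [->|] //; have := Hbot u; lia.
  have -> /= : w t.+1 = 1 by apply: (@code1 _ (top w t.+1)).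
  split=> [u ut un|_ u ut un1 un2].
    by case: (eqVneq u t.+1) => [->|] //; have := Htop u; lia.
  by apply: lt3; lia.
have [] := code2 bot_t top_t bot_top lt2 lt1; rewrite -/w.
case: (w t.+1) => [|[|k]] //= _ _; split=> [u ut un|_ u ut un1 un2].
  by case: (eqVneq u t.+1) => [->|] //; have := Htop u; lia.
by case: (eqVneq u t.+1) => [->|] //; have := Hbot u; lia.
Qed.

(** As letters are at most 2, two distinct larger vertices exhaust [greater_before p t]; by
    [top2_max] they are the top two. *)
Lemma code_eq2 t u v : t < n -> u <> v ->
  [/\ u \in greater_before p t & v \in greater_before p t] <->
  w t = 2 /\ edge w t u v.
Proof.
move=> tn uv.
have w2 : w t = 2 -> forall x,
    (x \in greater_before p t) = (x == top w t) || (x == bot w t).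
  move=> wt; have t1 := two_gt1 code_le wt.
  have [|Htop /(_ t1) Hbot] := @top2_max t; first by lia.
  have top_t := top_lt code_le (ltnW t1).
  have [bot_t bot_top] := bot_lt code_le t1; rewrite -/w in top_t bot_t bot_top.
  have neq x : x < t -> p x <> p t by move=> xt /p_inj; lia.
  have lt1 := Htop _ bot_t bot_top.
  have lt2 : p t < p (bot w t).
    have [//|bt|e] := ltngtP (p t) (p (bot w t)); last by have := neq _ bot_t; lia.
    have lt3 x : x < t -> x <> top w t -> p x < p t.
      by move=> xt xn; case: (eqVneq x (bot w t)) => [->|] //; have := Hbot x; lia.
    have [tt|tt|e] := ltngtP (p t) (p (top w t)).
    - by have := code1 top_t lt3 tt; rewrite -/w wt.
    - by have := code0 Htop tt; rewrite -/w wt.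
    - by have := neq _ top_t; lia.
  have [] := @code2 t (top w t) (bot w t); rewrite -/w //; try by lia.
  by move=> _; apply.
split=> [[ut vt]|[wt]].
  have wt : w t = 2.
    apply/eqP; rewrite eqn_leq code_le2 //=.
    apply: (@uniq_leq_size _ [:: u; v]) => [|x]; first by rewrite /= inE andbT; apply/eqP.
    by rewrite !inE => /orP[] /eqP ->.
  split=> //; move: ut vt; rewrite !w2 // /edge; lia.
by rewrite !w2 // /edge => e; split; lia.
Qed.

Lemma perm_adjP u v : perm_adj n p u v <-> word_adj n w u v.
Proof.
split=> [[uv [t [tn ut vt]]]|[t [tn wt e]]].
  by have [wt e] : w t = 2 /\ edge w t u v by [apply/code_eq2]; exists t.
have [_ _ uv] := edge_lt code_le wt e; split=> //; exists t.
by have [] : [/\ u \in greater_before p t & v \in greater_before p t] by [apply/code_eq2].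
Qed.

Lemma tree_perm_word par m : tree_perm par m n p <-> tree_word par m n w.
Proof.
split=> -[h [hinj hadj hcov hwt]]; exists h; split=> //.
- by move=> i j im jm; rewrite -perm_adjP; apply: hadj.
- by move=> u v /perm_adjP; apply: hcov.
- move=> s t u v sn tn ws wt es et.
  have [_ _ uv] := edge_lt code_le ws es.
  have [us vs] : [/\ u \in greater_before p s & v \in greater_before p s] by [apply/code_eq2].
  have [ut vt] : [/\ u \in greater_before p t & v \in greater_before p t] by [apply/code_eq2].
  exact: (hwt s t u v).
- by move=> i j im jm; rewrite perm_adjP; apply: hadj.
- by move=> u v /perm_adjP; apply: hcov.
- move=> s t u v sn tn uv us vs ut vt.
  have [ws es] : w s = 2 /\ edge w s u v by [apply/code_eq2].
  have [wt et] : w t = 2 /\ edge w t u v by [apply/code_eq2].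
  exact: (hwt s t u v).
Qed.

End Code.

(** Three larger values before [t] would be pairwise adjacent through [t], and a tree contains no
    triangle. *)
Lemma tree_perm_code_le2 par m n p : (forall k, par k <= k) ->
  tree_perm par m n p -> forall t, t < n -> code p t <= 2.
Proof.
move=> par_le [h [hinj hadj hcov _]] t tn; rewrite leqNgt; apply/negP => c3.
pose g k := nth 0 (greater_before p t) k.
have gadj i j : i < 3 -> j < 3 -> i != j -> perm_adj n p (g i) (g j).
  move=> i3 j3 ij; have mem k : k < 3 -> g k \in greater_before p t.
    by move=> k3; apply: mem_nth; rewrite -/(code p t); lia.
  split; last by exists t; rewrite !mem.
  move=> /eqP; rewrite nth_uniq ?uniq_greater // -/(code p t); lia.
have [i im ei] := hcov _ _ (gadj 0 1 isT isT isT).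
have [j jm ej] := hcov _ _ (gadj 1 2 isT isT isT).
have [k km ek] := hcov _ _ (gadj 2 0 isT isT isT).
have := gadj 0 1 isT isT isT; have := gadj 1 2 isT isT isT.
have := gadj 2 0 isT isT isT.
rewrite ei ej ek => /hadj aki /hadj ajk /hadj aij.
move: (aki km im) (ajk jm km) (aij im jm) => {aki ajk aij}.
rewrite /tree_adj; have := par_le i.-1; have := par_le j.-1; have := par_le k.-1.
have nij : i <> j by move=> e; have [] := gadj 0 1 isT isT isT; rewrite ei ej e.
have njk : j <> k by move=> e; have [] := gadj 1 2 isT isT isT; rewrite ej ek e.
have nki : k <> i by move=> e; have [] := gadj 2 0 isT isT isT; rewrite ek ei e.
by lia.
Qed.

(** Vertices outside the image of an embedding covering all edges are isolated; enumerating them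
    supplies the added vertices. *)
Lemma iso_add_isolatedP (W G : wgraph) :
  (exists k, wgraph_iso W (add_isolated G k)) <->
  exists h : vertex G -> vertex W,
    [/\ injective h, forall x y, adj (h x) (h y) = adj x y,
        forall u v, adj u v -> u \in codom h
      & forall x y, adj x y -> weight (h x) (h y) = weight x y].
Proof.
split=> [[k [f [[g fK gK] fadj fwt]]] | [h [hinj hadj hcov hwt]]].
  exists (fun x => g (inl x)); split.
  - by move=> x y /(can_inj gK)[].
  - by move=> x y; rewrite -fadj !gK.
  - move=> u v; rewrite -fadj; case fu: (f u) => [x|] //= _.
    by apply/codomP; exists x; rewrite -fu fK.
  - by move=> x y xy; rewrite -fwt ?gK // -fadj !gK.
pose C := [predC codom h]; exists #|C|.
pose g (z : vertex G + 'I_#|C|) := match z with inl x => h x | inr j => enum_val j end.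
have valC (j : 'I_#|C|) : enum_val j \notin codom h by have := enum_valP j; rewrite inE.
have ginj : injective g.
  move=> [x|i] [y|j] //=; first by move=> /hinj ->.
  - by move=> e; have := valC j; rewrite -e codom_f.
  - by move=> e; have := valC i; rewrite e codom_f.
  - by move=> /enum_val_inj ->.
have gbij : bijective g.
  apply: inj_card_bij => //; rewrite card_sum card_ord -(card_codom hinj).
  by rewrite cardC.
have gadj x y : adj (g x) (g y) = isolated_adj x y.
  case: x y => [x|i] [y|j] //=; apply/negP => /[dup] a.
  - by rewrite adj_sym => /hcov; apply/negP/valC.
  - by move=> /hcov; apply/negP/valC.
  - by move=> /hcov; apply/negP/valC.
case: gbij => f gK fK; exists f; split; first by exists g.
- by move=> u v; rewrite -[u in RHS]fK -[v in RHS]fK gadj.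
- move=> u v; rewrite -[u in adj u]fK -[v in adj _ v]fK -[in RHS](fK u) -[in RHS](fK v).
  rewrite gadj /=; case: (f u) (f v) => [x|i] [y|j] //=.
  by move=> xy; rewrite hwt.
Qed.

(** * Competition graphs in insertion order *)

Section Insertion.
Variables (n' : nat).
Local Notation n := n'.+1.

(* Positions are read from right to left; the value [n] past the end makes all
   letters of the code vanish there. *)
Definition insertion (pi : 'S_n) (t : nat) : nat :=
  if t < n then val (pi (rev_ord (inord t))) else n.

Lemma insertionE pi (v : 'I_n) : insertion pi v = pi (rev_ord v).
Proof. by rewrite /insertion ltn_ord inord_val. Qed.

Lemma insertion_inj pi u v : u < n -> v < n ->
  insertion pi u = insertion pi v -> u = v.
Proof.
move=> un vn; rewrite /insertion un vn => /val_inj/perm_inj/rev_ord_inj.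
by move=> /(congr1 val); rewrite /= !inordK.
Qed.

Lemma arc_insertion (pi : 'S_n) (u v : 'I_n) :
  Defs.arc pi (rev_ord u) (rev_ord v) = (val u \in greater_before (insertion pi) v).
Proof.
rewrite mem_greater !insertionE /Defs.arc /=; congr (_ && _).
by have := ltn_ord u; have := ltn_ord v; lia.
Qed.

Lemma comp_adj_insertion (pi : 'S_n) (u v : 'I_n) :
  comp_adj pi (rev_ord u) (rev_ord v) <-> perm_adj n (insertion pi) u v.
Proof.
split=> [/andP[uv /existsP[i]]|[uv [t [tn ut vt]]]].
  rewrite inE -[i]rev_ordK !arc_insertion => /andP[ui vi].
  split; last by exists (rev_ord i).
  by move=> /val_inj e; rewrite e eqxx in uv.
apply/andP; split; first by apply/eqP => /rev_ord_inj e; apply: uv; rewrite e.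
apply/existsP; exists (rev_ord (inord t)); rewrite inE !arc_insertion inordK //.
by rewrite ut vt.
Qed.

Lemma W_inv_tree m par (a : rel 'I_m.+1) symA irrA symW (pi : 'S_n) :
    0 < m -> (forall k, par k <= k) -> (forall i j, a i j = tree_adj par i j) ->
  pi \in W_inv n (@WGraph _ a (fun _ _ => 1) symA irrA symW) <->
  tree_perm par m n (insertion pi).
Proof.
move=> m0 par_le aE; rewrite inE; split=> [/asboolP|].
  move=> /iso_add_isolatedP[h [/= hinj hadj hcov hwt]].
  exists (fun i => rev_ord (h (inord i))); split.
  - move=> i j im jm /val_inj/rev_ord_inj/hinj/(congr1 val).
    by rewrite /= !inordK.
  - move=> i j im jm; rewrite -comp_adj_insertion !rev_ordK hadj aE.
    by rewrite !inordK.
  - move=> u v uv.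
    have [un vn] : u < n /\ v < n.
      by case: uv => _ [t [tn]]; rewrite !mem_greater; lia.
    rewrite -(inordK un) -(inordK vn) in uv.
    move: uv => /comp_adj_insertion/hcov/codomP[x ux].
    exists x; first by rewrite -ltnS ltn_ord.
    by rewrite inord_val -ux rev_ordK inordK.
  - move=> s t u v sn tn uv us vs ut vt.
    have [un vn] : u < n /\ v < n.
      by move: us vs; rewrite !mem_greater; lia.
    pose u' : 'I_n := Ordinal un; pose v' : 'I_n := Ordinal vn.
    pose s' : 'I_n := Ordinal sn; pose t' : 'I_n := Ordinal tn.
    have cs : rev_ord s' \in common_out pi (rev_ord u') (rev_ord v').
      by rewrite inE !arc_insertion us vs.
    have ct : rev_ord t' \in common_out pi (rev_ord u') (rev_ord v').
      by rewrite inE !arc_insertion ut vt.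
    have auv : comp_adj pi (rev_ord u') (rev_ord v').
      by apply/comp_adj_insertion; split=> //; exists s.
    have /codomP[x ex] := hcov _ _ auv.
    have /codomP[y ey] : rev_ord v' \in codom h.
      by apply: (hcov _ (rev_ord u')); rewrite comp_adj_sym.
    (* Weight 1 makes [common_out] a singleton, so [s] and [t] coincide. *)
    have := hwt x y; rewrite -hadj -ex -ey => /(_ auv)/eqP.
    rewrite /comp_weight => /cards1P[z cz].
    move: cs ct; rewrite cz !inE => /eqP es /eqP et.
    by have /(congr1 val) : s' = t' by [apply: rev_ord_inj; rewrite es et].
case=> h [hinj hadj hcov hwt]; apply/asboolP/iso_add_isolatedP.
(* Every [h i] is an end of an edge and hence a genuine position; for [i = 0] this is the edge to
   vertex 1, present as [0 < m]. *)
have hn i : i <= m -> h i < n.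
  have adj_lt u v : perm_adj n (insertion pi) u v -> u < n /\ v < n.
    by case=> _ [t [tn]]; rewrite !mem_greater; lia.
  have hn0 k : k < m -> h (par k) < n /\ h k.+1 < n.
    move=> km; apply: adj_lt; apply/hadj; rewrite ?tree_adj_par //.
    by have := par_le k; lia.
  case: i => [_|k km]; last by have [] := hn0 k km.
  by have [] := hn0 0 m0; have := par_le 0; rewrite leqn0 => /eqP ->.
have hadj' (i j : 'I_m.+1) :
    comp_adj pi (rev_ord (inord (h i))) (rev_ord (inord (h j))) = a i j.
  rewrite aE; apply/idP/idP.
    move=> /comp_adj_insertion; rewrite !inordK ?hn -1?ltnS // => /hadj.
    by apply; rewrite -ltnS.
  move=> ij; apply/comp_adj_insertion; rewrite !inordK ?hn -1?ltnS //.
  by apply/hadj; rewrite // -ltnS.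
exists (fun i : 'I_m.+1 => rev_ord (inord (h i)) : 'I_n); split=> //=.
- move=> i j /rev_ord_inj/(congr1 val); rewrite /= !inordK ?hn -1?ltnS // => /hinj e.
  by apply/val_inj/e; rewrite -ltnS.
- move=> u v; rewrite -[u]rev_ordK -[v]rev_ordK => /comp_adj_insertion/hcov[i im e].
  apply/codomP; exists (inord i); congr rev_ord.
  by apply: val_inj; rewrite /= !inordK // -e.
- move=> i j; rewrite -hadj'.
  move: (rev_ord (inord (h i))) (rev_ord (inord (h j))) => u v.
  move=> /[dup] /andP[_ /existsP[z zc]].
  rewrite -[u]rev_ordK -[v]rev_ordK => /comp_adj_insertion[uv _].
  rewrite !rev_ordK /comp_weight; apply/eqP/cards1P; exists z.
  apply/setP => x; rewrite in_set1; apply/idP/eqP => [xc|-> //].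
  move: xc zc; rewrite !inE -[x]rev_ordK -[z]rev_ordK -{1 2}[u]rev_ordK -{1 2}[v]rev_ordK.
  rewrite !arc_insertion => /andP[ux vx] /andP[uz vz].
  apply/(congr1 (@rev_ord _))/val_inj.
  exact: (hwt _ _ _ _ (ltn_ord _) (ltn_ord _) uv).
Qed.

End Insertion.

(* The positions of larger earlier values form an up-set of the earlier values
   ordered by [p], so their number determines them. *)
Lemma code_order n p q :
    (forall u v, u < n -> v < n -> p u = p v -> u = v) ->
    (forall u v, u < n -> v < n -> q u = q v -> u = v) ->
    (forall t, t < n -> code p t = code q t) ->
  forall u v, u < n -> v < n -> (p u < p v) = (q u < q v).
Proof.
have half p' q' t u : (forall x y, x < t -> y < t -> (p' x < p' y) = (q' x < q' y)) ->
    (forall x y, x <= t -> y <= t -> q' x = q' y -> x = y) ->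
    code p' t = code q' t -> u < t -> p' t < p' u -> q' t < q' u.
  move=> pq q_inj cpq ut ptu; rewrite ltnNge; apply/negP => qut.
  (* If [u] were not above [t] for [q'], everything above [t] for [q'] would be above [u], hence
     above [t] for [p']; with [u] itself this is one element too many. *)
  suff : size (u :: greater_before q' t) <= size (greater_before p' t).
    by rewrite /= -/(code q' t) -/(code p' t) cpq ltnn.
  apply: uniq_leq_size => [|x].
    by rewrite /= uniq_greater andbT mem_greater; lia.
  rewrite inE !mem_greater => /predU1P[->|]; first by rewrite ut.
  by move=> /andP[xt qtx]; rewrite xt; have := pq u x ut xt; lia.
move=> p_inj q_inj cpq.
have main t : t <= n -> forall u v, u < t -> v < t -> (p u < p v) = (q u < q v).
  elim: t => // t IH tn u v ut vt.
  have {}IH := IH (ltnW tn).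
  have new x : x < t -> (p t < p x) = (q t < q x).
    move=> xt; apply/idP/idP; apply: half => //.
    - by move=> y z yt zt; apply: q_inj; lia.
    - exact: cpq.
    - by move=> y z yt zt; rewrite IH.
    - by move=> y z yt zt; apply: p_inj; lia.
    - by rewrite cpq.
  have [ut'|->] : u < t \/ u = t by lia.
    have [vt'|->] : v < t \/ v = t by lia.
      exact: IH.
    have := new u ut'; have := p_inj u t; have := q_inj u t; lia.
  have [vt'|->] : v < t \/ v = t by lia.
    exact: new.
  by rewrite !ltnn.
exact: main.
Qed.

Lemma card_ltn_ord n k : k <= n -> #|[pred i : 'I_n | i < k]| = k.
Proof. by move=> kn; rewrite -sum1_card (big_ord_narrow kn) sum1_card card_ord. Qed.

(** * Codes as finite functions, and the count *)

Section Counting.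
Variable n' : nat.
Local Notation n := n'.+1.

(** Each value of a permutation is its rank, the number of smaller values. *)
Lemma perm_order_inj (s t : 'S_n) :
  (forall x y, (s x < s y) = (t x < t y)) -> s = t.
Proof.
have rank (u : 'S_n) x : val (u x) = #|[set y | u y < u x]|.
  have -> : [set y | u y < u x] = u @^-1: [set z : 'I_n | z < u x].
    by apply/setP => y; rewrite !inE.
  rewrite card_preimset; last exact: perm_inj.
  by rewrite cardsE card_ltn_ord // ltnW.
move=> st; apply/permP => x; apply: val_inj; rewrite [LHS]rank [RHS]rank.
by apply: eq_card => y; rewrite !inE st.
Qed.

Definition letters (c : {ffun 'I_n -> 'I_n}) t : nat :=
  if t < n then val (c (inord t)) else 0.

Definition perm_code (pi : 'S_n) : {ffun 'I_n -> 'I_n} :=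
  [ffun v : 'I_n => inord (code (insertion pi) v)].

Lemma letters_perm_code pi : letters (perm_code pi) = code (insertion pi).
Proof.
apply: funext => t; rewrite /letters; case: ltnP => tn.
  rewrite ffunE /= (inordK tn) inordK //.
  exact: leq_ltn_trans (code_le _ t) tn.
apply/esym/eqP; rewrite size_eq0 -[_ == _]negbK -has_filter; apply/hasPn => u _.
rewrite /insertion (leq_gtF tn); case: ifP => _; last by rewrite ltnn.
by rewrite -leqNgt; apply/ltnW/ltn_ord.
Qed.

Lemma perm_code_inj : injective perm_code.
Proof.
move=> s t st.
have cst u : code (insertion s) u = code (insertion t) u.
  by rewrite -!letters_perm_code st.
apply: perm_order_inj => x y; rewrite -[x]rev_ordK -[y]rev_ordK -!insertionE.
by apply: code_order (ltn_ord _) (ltn_ord _) => [||u _]; [exact: insertion_inj..|].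
Qed.

Definition codes := [set c : {ffun 'I_n -> 'I_n} | [forall v, c v <= v]].

Lemma codesP c : reflect (forall t, letters c t <= t) (c \in codes).
Proof.
rewrite inE; apply: (iffP forallP) => [cle t|cle v].
  by rewrite /letters; case: ltnP => // tn; have := cle (inord t); rewrite inordK.
by have := cle v; rewrite /letters ltn_ord inord_val.
Qed.

(** Surjectivity by counting: [perm_code] is injective, and [v.+1] choices for each letter give [n!]
    codes. *)
Lemma perm_code_image : perm_code @: setT = codes.
Proof.
apply/eqP; rewrite eqEcard; apply/andP; split.
  apply/subsetP => _ /imsetP[s _ ->]; apply/codesP => t.
  by rewrite letters_perm_code code_le.
rewrite card_imset; last exact: perm_code_inj.
rewrite cardsT card_Sn.
have -> : #|codes| = #|family (fun v : 'I_n => [pred x : 'I_n | x < v.+1])|.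
  by apply: eq_card => c; rewrite inE; apply: eq_forallb => v.
rewrite card_family /image_mem foldrE big_map big_enum /= fact_prod big_add1 big_mkord.
by apply: eq_leq; apply: eq_bigr => i _; rewrite card_ltn_ord.
Qed.

Definition chain_codes m b :=
  [set c in codes | `[< chain_word m n (letters c) /\ inner_eq n (letters c) b >]].

Lemma card_chain_codes m b (A : {set 'S_n}) :
    (forall pi, pi \in A <-> chain_word m n (code (insertion pi)) /\
                             inner_eq n (code (insertion pi)) b) ->
  #|A| = #|chain_codes m b|.
Proof.
move=> AP; rewrite -(card_imset _ perm_code_inj); apply: eq_card => c.
rewrite inE -perm_code_image; apply/imsetP/andP => [[pi /AP piA ->]|].
  by split; [exact: imset_f | apply/asboolP; rewrite letters_perm_code].
by case=> /imsetP[pi _ ->] /asboolP; rewrite letters_perm_code => /AP; exists pi.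
Qed.

Definition flip_code (c : {ffun 'I_n -> 'I_n}) : {ffun 'I_n -> 'I_n} :=
  [ffun v : 'I_n => inord (flip n (letters c) v)].

Lemma letters_flip_code c : c \in codes ->
  letters (flip_code c) = flip n (letters c).
Proof.
move=> /codesP cle; apply: funext => t; rewrite {1}/letters; case: ltnP => tn.
  rewrite ffunE /= (inordK tn) inordK //.
  exact: leq_ltn_trans (flip_le n t cle) tn.
have lt0 : letters c t = 0 by rewrite /letters ltnNge tn.
rewrite /flip lt0; case: ifP => // /andP[/innerP[s [q []]]].
by lia.
Qed.

(** [flip_code] is injective because [flip] is an involution; the cases [b = 0] and [b = 1] together
    give equality. *)
Lemma leq_chain_codes m b : b <= 1 -> #|chain_codes m b| <= #|chain_codes m (1 - b)|.
Proof.
move=> b1; rewrite -(@card_in_imset _ _ flip_code).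
  apply: subset_leq_card; apply/subsetP => _ /imsetP[c + ->].
  rewrite !inE => /andP[cC /asboolP[cQ cb]].
  have cC' : c \in codes by rewrite inE.
  rewrite letters_flip_code //; apply/andP; split.
    suff : flip_code c \in codes by rewrite inE.
    apply/codesP => t; rewrite letters_flip_code //; apply: flip_le.
    exact/codesP.
  by apply/asboolP; split; [exact: chain_flip | exact: (inner_eq_flip cQ)].
move=> c d; rewrite !inE => /andP[cC _] /andP[dC _] cd.
have cC' : c \in codes by rewrite inE.
have dC' : d \in codes by rewrite inE.
apply/ffunP => v; apply: val_inj.
have : letters c v = letters d v.
  rewrite -[LHS](flipK n) -[RHS](flipK n).
  by rewrite -(letters_flip_code cC') -(letters_flip_code dC') cd.
by rewrite /letters ltn_ord inord_val.
Qed.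

End Counting.

Theorem mainTheorem10 (m n : nat) (hm : 1 <= m) (hn : 1 <= n) :
  #|W_inv n (path_graph m)| = #|W_inv n (star_graph m)|.
Proof.
case: n hn => // n _.
(* Path and star differ only in the parent function and in the inner letter [b]: 0 for the path, 1
   for the star. *)
have reduce par b (A : {set 'S_n.+1}) : (forall k, par k <= k) ->
    (forall pi, pi \in A <-> tree_perm par m n.+1 (insertion pi)) ->
    (forall w, (forall t, w t <= t) -> (forall t, t < n.+1 -> w t <= 2) ->
       tree_word par m n.+1 w <-> chain_word m n.+1 w /\ inner_eq n.+1 w b) ->
    #|A| = #|chain_codes n m b|.
  move=> par_le AP wP; apply: card_chain_codes => pi; rewrite AP.
  have inj := @insertion_inj n pi; have cle := code_le (insertion pi).
  split=> [/[dup] /(tree_perm_code_le2 par_le) c2|wb].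
    by rewrite (tree_perm_word inj c2) (wP _ cle c2).
  have c2 : forall t, t < n.+1 -> code (insertion pi) t <= 2 by case: wb => -[].
  by rewrite (tree_perm_word inj c2) (wP _ cle c2).
rewrite (reduce id 0) //; last 2 first.
- move=> pi; apply: W_inv_tree => // i j.
  by rewrite /path_adj /tree_adj; lia.
- by move=> w w_le; apply: path_wordP.
rewrite (reduce (fun=> 0) 1) //; last 2 first.
- move=> pi; apply: W_inv_tree => // i j.
  by rewrite /star_adj /tree_adj -!val_eqE /=; lia.
- by move=> w w_le; apply: star_wordP.
by apply/eqP; rewrite eqn_leq (@leq_chain_codes n m 0) //= (@leq_chain_codes n m 1).
Qed.
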